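(* Let $\sigma\in\mathcal{W}_{2,ac}(\mathbb{R}^n)$ and $\mu\in\mathcal{W}_2(\mathbb{R}^n)$ be such that the optimal transport map from $\sigma$ to $\mu$ is $T_\sigma^\mu(x)=ax+b$ for some $a>0$, $b\in\mathbb{R}^n$. Then for any $P\in O(n)$ we have $T_{\sigma,\mu;P}=T_\sigma^\mu$ ($\sigma$-a.e.) and $\mathcal{U}(\sigma,\mu,P)=\mu$.
   Context: $\mathcal{W}_2(\mathbb{R}^n)$ is the set of Borel probability measures on $\mathbb{R}^n$ with finite second moment, and $\mathcal{W}_{2,ac}(\mathbb{R}^n)$ the subset of those absolutely continuous with respect to Lebesgue measure. For $\sigma\in\mathcal{W}_{2,ac}(\mathbb{R}^n)$ and $\mu\in\mathcal{W}_2(\mathbb{R}^n)$, $T_\sigma^\mu$ is the ($\sigma$-a.e. unique) minimizer of $\int\|T(x)-x\|^2d\sigma(x)$ over maps with $T_\sharp\sigma=\mu$; equivalently the unique gradient of a convex function pushing $\sigma$ to $\mu$. For $\theta\in S^{n-1}$, $\sigma^\theta$ is the pushforward of $\sigma$ under $x\mapsto x\cdot\theta$. For one-dimensional measures $\alpha$ (absolutely continuous) and $\beta$, $T_\alpha^\beta=F_\beta^{-1}\circ F_\alpha$ is the optimal transport map ($F_\alpha$ the cumulative distribution function, $F_\beta^{-1}$ the quantile function), i.e. the $\alpha$-a.e. unique nondecreasing map pushing $\alpha$ to $\beta$. For $P=[\theta_1,\ldots,\theta_n]\in O(n)$ (orthogonal matrix with columns $\theta_i$), $T_{\sigma,\mu;P}(x)=\sum_{i=1}^nT_{\sigma^{\theta_i}}^{\mu^{\theta_i}}(x\cdot\theta_i)\,\theta_i$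 and $\mathcal{U}(\sigma,\mu,P)=(T_{\sigma,\mu;P})_\sharp\sigma$. *)

(* Defs.v *)
From HB Require Import structures.
From mathcomp Require Import all_boot all_order all_algebra.
From mathcomp Require Import all_classical all_reals all_analysis.
From mathcomp Require Import measurable_realfun lra.
Import Order.TTheory GRing.Theory Num.Theory.
Import numFieldNormedType.Exports.

Set Implicit Arguments.
Unset Strict Implicit.
Unset Printing Implicit Defensive.

Local Open Scope classical_set_scope.
Local Open Scope ring_scope.

(* R^n is 'cV[R]_n.  The norm that the library puts on matrices is the sup
   norm; it induces the usual topology but it is not the Euclidean norm, hence
   [sqnorm] below. *)

(* The Borel sigma-algebra, generated by the open sets. *)
Definition borel_mx_display : measure_display.
Proof. exact: default_measure_display. Qed.

Section borel_matrix.
Context (R : realType) (m n : nat).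

Definition borel_mx : set (set 'M[R]_(m, n)) :=
  <<s [set A : set 'M[R]_(m, n) | open A] >>.

Let borel_mx0 : borel_mx set0.
Proof. exact: sigma_algebra0. Qed.

Let borel_mxC A : borel_mx A -> borel_mx (~` A).
Proof. exact: sigma_algebraC. Qed.

Let borel_mx_bigcup (F : (set 'M[R]_(m, n))^nat) :
  (forall i, borel_mx (F i)) -> borel_mx (\bigcup_i F i).
Proof. exact: sigma_algebra_bigcup. Qed.

HB.instance Definition _ := @isMeasurable.Build borel_mx_display
  'M[R]_(m, n) borel_mx borel_mx0 borel_mxC borel_mx_bigcup.

End borel_matrix.

Section euclidean.
Context (R : realType) (n : nat).
Implicit Types x y theta : 'cV[R]_n.

Definition dotv x y : R := \sum_(i < n) x i 0 * y i 0.

Definition sqnorm x : R := dotv x x.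

Definition orthogonal_group : set 'M[R]_n := [set P | P^T *m P = 1%:M].

(* x |-> x . theta *)
Definition proj_on theta x : R := dotv x theta.

Lemma measurable_coord (i : 'I_n) :
  measurable_fun [set: 'cV[R]_n] (fun x => x i 0).
Proof.
apply: (measurability _ (RGenOInfty.measurableE R)) => //.
move=> _ [_ [a ->] <-]; rewrite setTI; apply: sub_sigma_algebra => /=.
apply: open_comp; last exact: interval_open.
by move=> x _; exact: coord_continuous.
Qed.

Lemma measurable_fun_coord d (T : measurableType d) (f : T -> 'cV[R]_n) :
  (forall i, measurable_fun [set: T] (fun t => f t i 0)) ->
  measurable_fun [set: T] f.
Proof.
move=> mf.
apply: (@measurability _ _ _ _ _ _ [set A : set 'cV[R]_n | open A]) => //.
move=> _ [A oA <-]; rewrite setTI.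
pose B (qr : 'cV[rat]_n * rat) : set 'cV[R]_n :=
  [set x | forall i, ball (ratr (qr.1 i 0) : R) (ratr qr.2) (x i 0)].
have -> : A = \bigcup_(qr in [set qr | B qr `<=` A]) B qr.
  apply/seteqP; split=> [x Ax|x [qr /= BA] /BA//].
  have /nbhs_ballP[e /= e0 xeA] := open_nbhs_nbhs (conj oA Ax).
  have [r] := rat_in_itvoo (divr_gt0 e0 (ltr0n R 2)).
  rewrite in_itv/= => /andP[r0 re].
  have qE (i : 'I_n) : exists q : rat, `|x i 0 - ratr q| < ratr r.
    have /rat_in_itvoo[q] : x i 0 - ratr r < x i 0 + ratr r.
      by rewrite ltrD2l (lt_trans _ r0)// oppr_lt0.
    rewrite in_itv/= => /andP[xq qx]; exists q.
    by rewrite ltr_norml; apply/andP; split; lra.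
  pose q := \col_(i < n) xget 0%Q [set q : rat | `|x i 0 - ratr q| < ratr r].
  have xq (i : 'I_n) : `|x i 0 - ratr (q i 0)| < ratr r.
    rewrite mxE; case: xgetP => [y _//|/= nq].
    by have [q' hq'] := qE i; have := nq q'.
  exists (q, r) => /=; last by move=> i; rewrite /ball/= distrC.
  move=> y By; apply: xeA; split => // i j; rewrite (ord1 j) /ball/=.
  have := By i; rewrite /ball/= => yq.
  rewrite (le_lt_trans (ler_distD (ratr (q i 0)) _ _))//.
  by have := xq i; lra.
rewrite preimage_bigcup bigcup_mkcond; apply: countable_bigcupT_measurable.
  exact: countableP.
move=> qr; case: ifPn => // _.
rewrite [X in measurable X](_ : _ = \bigcap_(i in [set: 'I_n])
   (fun t => f t i 0) @^-1` ball (ratr (qr.1 i 0) : R) (ratr qr.2)); last first.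
  by apply/seteqP; split=> [t /= ft i _ | t /= ft i]; exact: ft.
apply: fin_bigcap_measurable; first exact: finite_finset.
move=> i _; rewrite -[X in measurable X]setTI; apply: mf => //.
by rewrite ball_itv; exact: measurable_itv.
Qed.

Lemma measurable_proj_on theta : measurable_fun [set: 'cV[R]_n] (proj_on theta).
Proof.
apply: measurable_sum => i.
by apply: measurable_funM => //; exact: measurable_coord.
Qed.

HB.instance Definition _ theta :=
  isMeasurableFun.Build _ _ _ _ (proj_on theta) (measurable_proj_on theta).

End euclidean.

Section wasserstein.
Context (R : realType) (n : nat).
Local Open Scope ereal_scope.

Definition box (a b : 'cV[R]_n) : set 'cV[R]_n :=
  [set x | forall i, (a i ord0 <= x i ord0 <= b i ord0)%R].

(* The n-dimensional Lebesgue outer measure.  Lebesgue measure is its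
   restriction to measurable sets, and [`<<] evaluates it only there.  The
   index set D allows finite coverings, so that the value at the empty set is 0
   also when n = 0. *)
Definition lebesgue_outer_Rn (A : set 'cV[R]_n) : \bar R :=
  ereal_inf [set v | exists (D : set nat) (a b : nat -> 'cV[R]_n),
    [/\ forall k i, (a k i ord0 <= b k i ord0)%R,
        A `<=` \bigcup_(k in D) box (a k) (b k) &
        v = \esum_(k in D) (\prod_(i < n) (b k i ord0 - a k i ord0)%R)%:E]].

Definition W2 : set (probability 'cV[R]_n R) :=
  [set mu | \int[mu]_x (sqnorm x)%:E < +oo].

Definition W2ac : set (probability 'cV[R]_n R) :=
  W2 `&` [set sigma | sigma `<< lebesgue_outer_Rn].

(* T_# sigma = mu; measures are compared on measurable sets only, because the
   underlying set functions are also defined on the others. *)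
Definition pushes (sigma mu : probability 'cV[R]_n R)
    (T : 'cV[R]_n -> 'cV[R]_n) : Prop :=
  measurable_fun [set: 'cV[R]_n] T /\
  forall A, measurable A -> pushforward sigma T A = mu A.

Definition transport_cost (sigma : probability 'cV[R]_n R)
    (T : 'cV[R]_n -> 'cV[R]_n) : \bar R :=
  \int[sigma]_x (sqnorm (T x - x)%R)%:E.

(* T is (a representative of) the optimal transport map from sigma to mu,
   which is only determined sigma-almost everywhere. *)
Definition optimal_transport_map (sigma mu : probability 'cV[R]_n R)
    (T : 'cV[R]_n -> 'cV[R]_n) : Prop :=
  pushes sigma mu T /\
  forall S, pushes sigma mu S -> transport_cost sigma T <= transport_cost sigma S.

End wasserstein.

Section slices.
Context (R : realType).

Definition real_id (x : R) : R := x.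

HB.instance Definition _ := @isMeasurableFun.Build _ _ _ _ real_id
  (@measurable_id _ _ setT).

(* The library attaches distribution functions to random variables: that of a
   law on R is the one of the identity. *)
Definition cdf1 (alpha : probability R R) : R -> \bar R :=
  cdf (real_id : {RV alpha >-> R}).

(* The left-continuous generalized inverse of the distribution function.
   [inf] is real-valued, with value 0 on sets that are empty or unbounded
   below, where the usual quantile is infinite.  This happens only for p = 0 or
   p = 1, and the t such that cdf1 alpha t is 0 or 1 form an alpha-null set when
   alpha is absolutely continuous. *)
Definition quantile (beta : probability R R) (p : \bar R) : R :=
  inf [set t | (p <= cdf1 beta t)%E].

Definition transport_map1 (alpha beta : probability R R) (t : R) : R :=
  quantile beta (cdf1 alpha t).

Lemma quantile_le beta (p q : \bar R) : (0 < p)%E -> (p <= q)%E -> (q < 1)%E ->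
  quantile beta p <= quantile beta q.
Proof.
move=> p0 pq q1.
have [u qu] : exists u, (q <= cdf1 beta u)%E.
  have /(_ [set y | q < y]%E) := @cvg_cdfy1 _ _ _ beta real_id.
  case; first by apply: open_nbhs_nbhs; split => //; exact: open_ereal_gt_ereal.
  by move=> M [_ /(_ (M + 1))]; rewrite ltrDl ltr01 => /(_ isT)/ltW; exists (M + 1).
have [l lp] : exists l, (cdf1 beta l < p)%E.
  have /(_ [set y | y < p]%E) := @cvg_cdfNy0 _ _ _ beta real_id.
  case; first by apply: open_nbhs_nbhs; split => //; exact: open_ereal_lt_ereal.
  move=> M [_ /(_ (M - 1))]; rewrite gtrDl oppr_lt0 ltr01 => /(_ isT).
  by exists (M - 1).
have lbl : lbound [set t | (p <= cdf1 beta t)%E] l.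
  move=> t /= pt; rewrite leNgt; apply/negP => tl.
  have tl' : (cdf1 beta t <= cdf1 beta l)%E by exact/cdf_nondecreasing/ltW.
  by have := le_lt_trans (le_trans pt tl') lp; rewrite ltxx.
apply: lb_le_inf; first by exists u.
move=> t /= qt; apply: ge_inf; first by exists l.
exact: le_trans qt.
Qed.

Lemma measurable_transport_map1 alpha beta :
  measurable_fun [set: R] (transport_map1 alpha beta).
Proof.
have F01 t : (0 <= cdf1 alpha t <= 1)%E by rewrite cdf_ge0 cdf_le1.
have mF : measurable_fun [set: R] (cdf1 alpha) by exact: cdf_measurable.
have mpre (B : set \bar R) : measurable B -> measurable (cdf1 alpha @^-1` B).
  by move=> mB; rewrite -[X in measurable X]setTI; exact: mF.
pose D p := cdf1 alpha @^-1` [set p].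
have mD p : measurable (D p) by apply: mpre; exact: emeasurable_set1.
have -> : [set: R] = D 0%E `|` D 1%E `|` ~` (D 0%E `|` D 1%E) by rewrite setUCr.
apply/measurable_funU; [exact: measurableU|exact/measurableC/measurableU|split].
  by apply/measurable_funU => //; split;
    apply: (eq_measurable_fun (cst (quantile beta _))) => [t|];
    rewrite ?inE//= /transport_map1 => ->.
have DC t : (~` (D 0%E `|` D 1%E)) t -> (0 < cdf1 alpha t < 1)%E.
  move=> /not_orP[/eqP t0 /eqP t1]; rewrite !lt_neqAle t1 eq_sym t0.
  exact: F01.
apply: (measurability _ (RGenCInfty.measurableE R)).
move=> _ [_ [a ->] <-]; apply: is_interval_measurable => s t /= [Ds sa] [Dt ta].
move=> u /andP[su ut].
have /andP[s0 s1] := DC _ Ds; have /andP[t0 t1] := DC _ Dt.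
have Fsu := cdf_nondecreasing (real_id : {RV alpha >-> R}) su.
have Fut := cdf_nondecreasing (real_id : {RV alpha >-> R}) ut.
have u1 := le_lt_trans Fut t1.
split.
  move=> [] ue; [have := lt_le_trans s0 Fsu|move: u1];
  by rewrite -/(cdf1 alpha) /= in ue *; rewrite ue ltxx.
move: sa; rewrite !in_itv/= !andbT => /le_trans; apply.
exact: quantile_le.
Qed.

Context (n : nat).
Implicit Types (sigma mu : probability 'cV[R]_n R) (P : 'M[R]_n).

(* sigma^theta *)
Definition slice sigma (theta : 'cV[R]_n) : probability R R :=
  distribution sigma (proj_on theta).

(* T_{sigma,mu;P} *)
Definition slice_transport_map sigma mu P (x : 'cV[R]_n) : 'cV[R]_n :=
  \sum_(i < n)
    transport_map1 (slice sigma (col i P)) (slice mu (col i P))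
      (proj_on (col i P) x) *: col i P.

Lemma measurable_slice_transport_map sigma mu P :
  measurable_fun [set: 'cV[R]_n] (slice_transport_map sigma mu P).
Proof.
apply: measurable_fun_coord => j.
under eq_fun do rewrite /slice_transport_map summxE.
apply: measurable_sum => i.
under eq_fun do rewrite mxE.
apply: measurable_funM => //.
apply: (measurableT_comp (measurable_transport_map1 _ _)).
exact: measurable_proj_on.
Qed.

HB.instance Definition _ sigma mu P := isMeasurableFun.Build _ _ _ _
  (slice_transport_map sigma mu P) (measurable_slice_transport_map sigma mu P).

(* U(sigma, mu, P) *)
Definition slice_update sigma mu P : probability 'cV[R]_n R :=
  distribution sigma (slice_transport_map sigma mu P).

End slices.

(* Main.v *)
Require Import Defs.
From HB Require Import structures.
From mathcomp Require Import all_boot all_order all_algebra.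
From mathcomp Require Import all_classical all_reals all_analysis.
From mathcomp Require Import measurable_realfun.
Import Order.TTheory GRing.Theory Num.Theory.
Import numFieldNormedType.Exports.

Set Implicit Arguments.
Unset Strict Implicit.
Unset Printing Implicit Defensive.

Local Open Scope classical_set_scope.
Local Open Scope ring_scope.

(** For each direction [theta], pushing the affine relation
    [mu = (a x + b)_# sigma] forward under [x |-> x . theta] shows that the
    slices satisfy [F_mu (a t + b . theta) = F_sigma t].  Hence the
    one-dimensional map [F_mu^-1 o F_sigma] sends [t] to [a t + b . theta] at
    every [t] to the left of which [F_sigma] is strictly smaller.  The remaining
    [t] lie in countably many intervals on which [F_sigma] is constant, so they
    form a null set.  Summing over the orthonormal basis of the columns of [P]
    rebuilds [a x + b]. *)

(** Extends countable subadditivity from sequences to unions over the rationals, by enumerating [I]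
    through [pickle]. *)
Lemma negligible_bigcup_countType d (T : measurableType d) (R : realFieldType)
    (mu : {measure set T -> \bar R}) (I : countType) (F : I -> set T) :
  (forall i, mu.-negligible (F i)) -> mu.-negligible (\bigcup_i F i).
Proof.
move=> F0.
pose G k := if @unpickle I k is Some i then F i else set0.
apply: (@negligibleS _ _ _ _ (\bigcup_k G k)).
  by move=> x [i _ Fix]; exists (pickle i) => //; rewrite /G pickleK.
apply: negligible_bigcup => k; rewrite /G.
by case: unpickle => // ; exact: negligible_set0.
Qed.

(** The preimages differ only inside a null set [N], so each is contained in the union of the other
    with [N]. *)
Lemma ae_eq_preimage d d' (T : measurableType d) (U : measurableType d')
    (R : realType) (mu : {measure set T -> \bar R}) (f g : T -> U) (A : set U) :
  measurable_fun setT f -> measurable_fun setT g -> measurable A ->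
  {ae mu, forall x, f x = g x} -> mu (f @^-1` A) = mu (g @^-1` A).
Proof.
have le_pre (h k : T -> U) : measurable_fun setT h -> measurable_fun setT k ->
    measurable A -> {ae mu, forall x, h x = k x} ->
    (mu (h @^-1` A) <= mu (k @^-1` A))%E.
  move=> mh mk mA [N [mN N0 hkN]].
  have mpre (l : T -> U) : measurable_fun setT l -> measurable (l @^-1` A).
    by move=> ml; rewrite -[X in measurable X]setTI; exact: ml.
  rewrite -[leRHS]adde0 -N0.
  apply: le_trans (measureU2 _ _ _) => //; last exact: mpre.
  apply: le_measure; rewrite ?inE.
  - exact: mpre.
  - by apply: measurableU => //; exact: mpre.
  move=> x /= Ahx; have [hkx|hkx] := pselect (h x = k x).
    by left; rewrite -hkx.
  by right; exact: hkN.
move=> mf mg mA fg; apply/eqP; rewrite eq_le !le_pre//.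
by apply: filterS fg => x ->.
Qed.

Section cdf_flat.
Context (R : realType).
Implicit Types alpha beta : probability R R.

Lemma cdf1E alpha t : cdf1 alpha t = alpha `]-oo, t]%classic.
Proof. by []. Qed.

Lemma cdf1_le alpha s t : s <= t -> (cdf1 alpha s <= cdf1 alpha t)%E.
Proof. exact: cdf_nondecreasing. Qed.

(** Splitting []-oo, t]] at [s] shows that the mass of []s, t]] is the increment of the distribution
    function; the value at [s] cancels because it is finite. *)
Lemma negligible_cdf1_eq alpha (s t : R) :
  cdf1 alpha s = cdf1 alpha t -> alpha.-negligible `]s, t]%classic.
Proof.
move=> Fst; have [ts|st] := leP t s.
  by rewrite set_itv_ge ?bnd_simp -?leNgt//; exact: negligible_set0.
apply/negligibleP => //.
have : cdf1 alpha t = (cdf1 alpha s + alpha `]s, t]%classic)%E.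
  rewrite !cdf1E -measureU//.
    by rewrite -itv_bndbnd_setU// bnd_simp ltW.
  by apply/seteqP; split => x //= []; rewrite !in_itv/= => xs /andP[];
    rewrite ltNge xs.
move=> FtD; apply/eqP; rewrite -measure_le0.
rewrite -(leeD2lE (x := cdf1 alpha s)) ?adde0; last first.
  by rewrite cdf1E fin_num_measure.
by rewrite -FtD Fst.
Qed.

(* [B q] is an interval with left end q, which may or may not contain its right
   end: if it does, it is itself a null interval, and otherwise it is covered by
   the null intervals ]q, r] with r rational. *)
Lemma ae_cdf1_lt alpha :
  {ae alpha, forall t, forall s, s < t -> (cdf1 alpha s < cdf1 alpha t)%E}.
Proof.
pose F := cdf1 alpha.
pose B (q : R) := [set t : R | q < t /\ F q = F t].
have B0 q : alpha.-negligible (B q).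
  have [[m [[qm Fqm] Bm]]|nomax] :=
      pselect (exists m, B q m /\ forall t, B q t -> t <= m).
    apply: (negligibleS _ (negligible_cdf1_eq Fqm)) => t Bt /=.
    by rewrite in_itv/= (Bm _ Bt) andbT; case: Bt.
  pose G (r : rat) := [set t : R | F q = F (ratr r) /\ t \in `]q, ratr r]].
  apply: (@negligibleS _ _ _ _ (\bigcup_r G r)); last first.
    apply: negligible_bigcup_countType => r.
    have [Fqr|Fqr] := pselect (F q = F (ratr r)).
      by apply: (negligibleS _ (negligible_cdf1_eq Fqr)) => t [].
    by apply: (negligibleS _ (negligible_set0 _)) => t [/Fqr].
  move=> t [qt Fqt].
  have [t' [[qt' Fqt'] tt']] : exists t', B q t' /\ t < t'.
    apply: contra_notP nomax => /forallNP nt'; exists t; split => // u Bu.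
    by rewrite leNgt; apply/negP => tu; exact: (nt' u).
  have [r] := rat_in_itvoo tt'; rewrite in_itv/= => /andP[tr rt'].
  exists r => //; split; last by rewrite in_itv/= qt ltW.
  by apply/eqP; rewrite eq_le {2}Fqt' !cdf1_le// ltW// (lt_trans qt).
apply: (@negligibleS _ _ _ _ (\bigcup_(r : rat) B (ratr r))); last first.
  exact: negligible_bigcup_countType.
(* If some [s < t] violates the strict inequality, monotonicity makes [F] constant on [[s, t]], so
   [t] lies in [B (ratr r)] for any rational [r] between [s] and [t]. *)
move=> t /= /existsNP[s /not_implyP[st /negP]]; rewrite -leNgt => Fts.
have [r] := rat_in_itvoo st; rewrite in_itv/= => /andP[sr rt].
exists r => //; split => //; apply/eqP; rewrite eq_le; apply/andP; split.
  exact/cdf1_le/ltW.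
exact/(le_trans Fts)/cdf1_le/ltW.
Qed.

(** The point [a * t + c] is the least element of the set whose infimum is the quantile, so the
    default value of [inf] never intervenes. *)
Lemma transport_map1_affine alpha beta (a c t : R) : 0 < a ->
  (forall u, cdf1 beta (a * u + c) = cdf1 alpha u) ->
  (forall s, s < t -> (cdf1 alpha s < cdf1 alpha t)%E) ->
  transport_map1 alpha beta t = a * t + c.
Proof.
move=> a0 Fba lt_t; rewrite /transport_map1 /quantile.
set S := [set u | _]; have lbS : lbound S (a * t + c).
  move=> u /= tu; rewrite leNgt; apply/negP => ut; move: tu.
  (* Since [u < a * t + c] and [0 < a], the point [(u - c) / a] lies strictly to the left of [t],
     where the strict inequality applies. *)
  have -> : u = a * ((u - c) / a) + c.
    by rewrite mulrC divfK ?gt_eqF// subrK.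
  rewrite /S /= Fba leNgt lt_t//.
  by rewrite ltr_pdivrMr// ltrBlDr mulrC.
have St : S (a * t + c) by rewrite /S /= Fba.
apply/eqP; rewrite eq_le; apply/andP; split.
  by apply: ge_inf => //; exists (a * t + c).
by apply: lb_le_inf => //; exists (a * t + c).
Qed.

End cdf_flat.

Section euclidean_space.
Context (R : realType) (n : nat).
Implicit Types (sigma mu : probability 'cV[R]_n R) (P : 'M[R]_n).

Lemma proj_onE (theta x : 'cV[R]_n) : proj_on theta x = (theta^T *m x) 0 0.
Proof. by rewrite mxE; apply: eq_bigr => i _; rewrite mxE mulrC. Qed.

Lemma proj_on_affine (theta b x : 'cV[R]_n) (a : R) :
  proj_on theta (a *: x + b) = a * proj_on theta x + proj_on theta b.
Proof. by rewrite !proj_onE mulmxDr -scalemxAr !mxE. Qed.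

(** This is [P *m P^T *m x = x] read column by column; a left inverse of a square matrix is also a
    right inverse. *)
Lemma sum_proj_on_orthogonal P (x : 'cV[R]_n) : orthogonal_group P ->
  \sum_(i < n) proj_on (col i P) x *: col i P = x.
Proof.
move=> /mulmx1C PPt; rewrite -[RHS]mul1mx -PPt -mulmxA.
apply/colP => j; rewrite summxE [RHS]mxE; apply: eq_bigr => i _.
rewrite proj_onE !mxE mulrC; congr (_ * _); apply: eq_bigr => k _.
by rewrite !mxE.
Qed.

Lemma measurable_affine (a : R) (b : 'cV[R]_n) :
  measurable_fun setT (fun x : 'cV[R]_n => a *: x + b).
Proof.
apply: measurable_fun_coord => i; under eq_fun do rewrite !mxE.
apply: measurable_funD => //; apply: measurable_funM => //.
exact: measurable_coord.
Qed.

(** A slice is the law of [proj_on theta], so a null set of the slice pulls back to a [sigma]-null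
    set. *)
Lemma ae_slice sigma (theta : 'cV[R]_n) (Q : R -> Prop) :
  {ae slice sigma theta, forall t, Q t} ->
  {ae sigma, forall x, Q (proj_on theta x)}.
Proof.
move=> [N [mN N0 QN]]; exists (proj_on theta @^-1` N); split => //.
  by rewrite -[X in measurable X]setTI; exact: measurable_proj_on.
by move=> x; exact: QN.
Qed.

Lemma cdf1_slice_affine sigma mu (a : R) (b theta : 'cV[R]_n) : 0 < a ->
  (forall A, measurable A -> mu A = sigma ((fun x => a *: x + b) @^-1` A)) ->
  forall u, cdf1 (slice mu theta) (a * u + proj_on theta b) =
            cdf1 (slice sigma theta) u.
Proof.
move=> a0 muE u.
have -> v : cdf1 (slice mu theta) v = mu (proj_on theta @^-1` `]-oo, v]) by [].
rewrite muE.
  rewrite cdf1E; congr (sigma _); apply/seteqP; split => x /=;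
  by rewrite !in_itv/= proj_on_affine lerD2r ler_pM2l.
by rewrite -[X in measurable X]setTI; exact: measurable_proj_on.
Qed.

Lemma ae_slice_transport_map_affine sigma mu P (a : R) (b : 'cV[R]_n) :
  0 < a -> orthogonal_group P ->
  (forall A, measurable A -> mu A = sigma ((fun x => a *: x + b) @^-1` A)) ->
  {ae sigma, forall x, slice_transport_map sigma mu P x = a *: x + b}.
Proof.
move=> a0 oP muE.
have : {ae sigma, forall x, forall i : 'I_n,
    transport_map1 (slice sigma (col i P)) (slice mu (col i P))
      (proj_on (col i P) x) = proj_on (col i P) (a *: x + b)}.
  (* Only [n] directions occur, so their exceptional null sets can be handled one at a time. *)
  apply: filter_forall => i.
  have := ae_slice (ae_cdf1_lt (slice sigma (col i P))).
  apply: filterS => x ltx; rewrite proj_on_affine.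
  by apply: transport_map1_affine ltx => //; exact: cdf1_slice_affine.
apply: filterS => x Tx; rewrite -[RHS](sum_proj_on_orthogonal (a *: x + b) oP).
by apply: eq_bigr => i _; rewrite Tx.
Qed.

End euclidean_space.

Theorem corollary4p3 (R : realType) (n : nat)
    (sigma mu : probability 'cV[R]_n R)
    (hsigma : W2ac sigma) (hmu : W2 mu)
    (T : 'cV[R]_n -> 'cV[R]_n) (hT : optimal_transport_map sigma mu T)
    (a : R) (b : 'cV[R]_n) (ha : 0 < a)
    (hTab : {ae sigma, forall x, T x = a *: x + b})
    (P : 'M[R]_n) (hP : orthogonal_group P) :
  {ae sigma, forall x, slice_transport_map sigma mu P x = T x} /\
  (forall A : set 'cV[R]_n, measurable A ->
     slice_update sigma mu P A = mu A).
Proof.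
have [[mT Tmu] _] := hT.
(* The map [T] is only known almost everywhere, which suffices for the affine map to have the same
   pushforward [mu]. *)
have muE A : measurable A -> mu A = sigma ((fun x => a *: x + b) @^-1` A).
  move=> mA; rewrite -Tmu//.
  exact: (ae_eq_preimage mT (measurable_affine a b) mA hTab).
have STT : {ae sigma, forall x, slice_transport_map sigma mu P x = T x}.
  have := ae_slice_transport_map_affine ha hP muE.
  by apply: filterS2 hTab => x -> ->.
split => // A mA; rewrite -Tmu//.
exact: (ae_eq_preimage (measurable_slice_transport_map sigma mu P) mT mA STT).
Qed.
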